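(* Let $A \in \mathbb{Z}^{m\times n}$ with $\operatorname{rank}(A)=m\ge 1$, $b\in\mathbb{Z}^m$, $c\in\mathbb{Z}^n$, and assume $\max\{c^\top z : Az=b,\ z\in\mathbb{Z}^n_{\ge 0}\}$ is feasible and bounded. Let $B$ be an $m\times m$ submatrix of $A$ satisfying \[ \Delta \le |\det(B)|\cdot (2\log(m+1))^{m/2}, \] and let $U\in\mathbb{Z}^{m\times m}$ be a unimodular matrix (i.e. $|\det U|=1$) such that $UB$ is upper triangular. Consider ($U$-IP) $\max\{c^\top z : UAz=Ub,\ z\in\mathbb{Z}^n_{\ge 0}\}$ and its linear relaxation ($U$-LP) $\max\{c^\top x : UAx=Ub,\ x\in\mathbb{R}^n_{\ge 0}\}$. Then for every optimal vertex solution $x^*$ of ($U$-LP) there exists an optimal solution $z^*$ of ($U$-IP) satisfying \[ \|z^*-x^*\|_1 < 3m^2\log\Bigl(2\sqrt{2m\log(m+1)}\cdot \|UB\|_\infty\Bigr)\cdot (2\log(m+1))^{m/2}\cdot \|UB\|_\infty^m . \]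
   Context: $\Delta:=\Delta_m(A)$ is the largest absolute value of the determinant of an $m\times m$ submatrix of $A$. $\|M\|_\infty$ for a matrix $M$ denotes the largest absolute value of an entry of $M$. All logarithms $\log$ are base 2. *)

(* Defs.v *)
From HB Require Import structures.
From mathcomp Require Import all_boot all_order all_algebra.
From Stdlib Require Import Reals.
Set Implicit Arguments. Unset Strict Implicit. Unset Printing Implicit Defensive.
Import GRing.Theory Num.Theory.
Local Open Scope ring_scope.

Definition int2R (z : int) : R :=
  match z with Posz k => INR k | Negz k => Ropp (INR k.+1) end.

Definition log2 (x : R) : R := Rdiv (ln x) (ln (INR 2)).

Definition Rsum (n : nat) (f : 'I_n -> R) : R := \big[Rplus/R0]_(j < n) f j.

(* Delta_m(A): largest absolute value of the determinant of an m x m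
   submatrix of A (column selections; repeated columns give det 0). *)
Definition Delta_m (m n : nat) (A : 'M[int]_(m, n)) : nat :=
  \max_(f : {ffun 'I_m -> 'I_n}) absz (\det (colsub f A)).

Definition mx_inf_norm (m n : nat) (M : 'M[int]_(m, n)) : nat :=
  \max_(i < m) \max_(j < n) absz (M i j).

Definition upper_triangular (m : nat) (M : 'M[int]_m) : Prop :=
  forall i j : 'I_m, leq (nat_of_ord j).+1 (nat_of_ord i) -> M i j = 0.

Definition int_rank (m n : nat) (A : 'M[int]_(m, n)) : nat :=
  \rank (map_mx (fun a : int => (a%:~R : rat)) A).

Definition IP_feasible (m n : nat) (A : 'M[int]_(m, n)) (b : 'cV[int]_m)
  (z : 'cV[int]_n) : Prop :=
  (forall j, 0 <= z j 0) /\ A *m z = b.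

Definition obj (n : nat) (c : 'cV[int]_n) (z : 'cV[int]_n) : int :=
  \sum_(j < n) c j 0 * z j 0.

Definition IP_optimal (m n : nat) (A : 'M[int]_(m, n)) (b : 'cV[int]_m)
  (c : 'cV[int]_n) (z : 'cV[int]_n) : Prop :=
  IP_feasible A b z /\ forall y, IP_feasible A b y -> obj c y <= obj c z.

Definition LP_feasible (m n : nat) (A : 'M[int]_(m, n)) (b : 'cV[int]_m)
  (x : 'I_n -> R) : Prop :=
  (forall j, Rle R0 (x j)) /\
  forall i, Rsum (fun j => Rmult (int2R (A i j)) (x j)) = int2R (b i 0).

Definition LP_obj (n : nat) (c : 'cV[int]_n) (x : 'I_n -> R) : R :=
  Rsum (fun j => Rmult (int2R (c j 0)) (x j)).

Definition LP_optimal (m n : nat) (A : 'M[int]_(m, n)) (b : 'cV[int]_m)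
  (c : 'cV[int]_n) (x : 'I_n -> R) : Prop :=
  LP_feasible A b x /\
  forall y, LP_feasible A b y -> Rle (LP_obj c y) (LP_obj c x).

Definition LP_vertex (m n : nat) (A : 'M[int]_(m, n)) (b : 'cV[int]_m)
  (x : 'I_n -> R) : Prop :=
  LP_feasible A b x /\
  forall (y w : 'I_n -> R) (t : R),
    LP_feasible A b y -> LP_feasible A b w -> Rlt R0 t -> Rlt t R1 ->
    (forall j, x j = Rplus (Rmult t (y j)) (Rmult (Rminus R1 t) (w j))) ->
    forall j, y j = x j /\ w j = x j.

Definition l1_dist (n : nat) (z : 'cV[int]_n) (x : 'I_n -> R) : R :=
  Rsum (fun j => Rabs (Rminus (int2R (z j 0)) (x j))).

Definition absdet (m : nat) (M : 'M[int]_m) : nat := absz (\det M).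

Definition gamma_m (m : nat) : R :=
  Rpower (Rmult (INR 2) (log2 (Rplus (INR m) R1))) (Rdiv (INR m) (INR 2)).

(* Main.v *)
(* Replace A by UA, which changes neither Delta nor the integer program.

   Sparsity.  Choose an optimal integral z0 of minimal support, of size s.  No nonzero
   kernel vector with entries in {-1, 0, 1} is supported on supp z0, so the 2^s subset
   sums of the corresponding columns are distinct.  In the coordinates of a basis with
   determinant +-Delta all columns have entries at most 1 in absolute value, so these
   sums lie in a box of side s, which gives 2^s <= Delta (s + 1)^m.

   Proximity.  Among the optimal z supported on supp z0 and supp x take one closest to
   x in l1 norm.  The vector z - x is a nonnegative combination of at most s integral
   circuits conformal to it, because columns of supp x are independent.  Each circuit has
   l1 norm at most (m + 1) Delta by Cramer's rule, and each coefficient is less than 1: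
   otherwise subtracting the circuit from z would give a closer optimum.
   Hence |z - x|_1 < s (m + 1) Delta.

   Estimate.  As UB is triangular, Delta <= gamma_m |UB|^m, and the bound on s gives
   s (m + 1) <= 3 m^2 + (3/2) m^2 log m + 3 m log Delta. *)
Require Import Defs.
From Stdlib Require Import Reals Classical FunctionalExtensionality.
From Stdlib Require Lra.
From mathcomp Require Import all_boot all_order all_algebra.
From mathcomp Require Import zify ring lra Rstruct.
Import Order.TTheory GRing.Theory Num.Theory.
Local Open Scope ring_scope.
Set Implicit Arguments.
Unset Strict Implicit.
Unset Printing Implicit Defensive.

(** * Minors and subset sums *)

Definition replace_col (m n : nat) (g : 'I_m -> 'I_n) (k : 'I_m) (j : 'I_n) :=
  fun i => if i == k then j else g i.

(** Cramer's rule: expand the determinant along column [k]; its cofactors do not see the column that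
    was replaced. *)
Lemma adj_mul_colsub (R : comNzRingType) (m n : nat) (A : 'M[R]_(m, n))
  (g : 'I_m -> 'I_n) (k : 'I_m) (j : 'I_n) :
  (\adj (colsub g A) *m A) k j = \det (colsub (replace_col g k j) A).
Proof.
rewrite (expand_det_col _ k) mxE; apply: eq_bigr => i _.
rewrite !mxE mulrC /replace_col eqxx; congr (_ * _).
rewrite /cofactor; congr (_ * \det _); apply/matrixP => a b.
by rewrite !mxE eq_sym (negPf (neq_lift _ _)).
Qed.

Lemma colsubE (R : pzRingType) (m n p : nat) (A : 'M[R]_(m, n)) (g : 'I_p -> 'I_n) :
  colsub g A = A *m colsub g 1%:M.
Proof. by rewrite mulmx_colsub mulmx1. Qed.

Lemma minor_le_Delta_m (m n : nat) (A : 'M[int]_(m, n)) (g : 'I_m -> 'I_n) :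
  (absz (\det (colsub g A)) <= Delta_m A)%N.
Proof.
have -> : colsub g A = colsub (finfun g) A.
  by apply/matrixP => i j; rewrite !mxE ffunE.
exact: (leq_bigmax (F := fun f : {ffun 'I_m -> 'I_n} => absz (\det (colsub f A)))).
Qed.

Lemma Delta_m_attained (m n : nat) (A : 'M[int]_(m, n)) : (0 < Delta_m A)%N ->
  exists g : 'I_m -> 'I_n, Delta_m A = absz (\det (colsub g A)).
Proof.
move=> D0; have [|g Dg] := @bigop.eq_bigmax {ffun 'I_m -> 'I_n} (fun f => absz (\det (colsub f A))).
  rewrite lt0n; apply: contraL D0 => /eqP/card0_eq none.
  by rewrite /Delta_m big_pred0.
by exists g; rewrite -Dg.
Qed.

Lemma unimodularE (m : nat) (M : 'M[int]_m) :
  (M \in unitmx) = (absz (\det M) == 1%N).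
Proof.
rewrite unitmxE; apply/idP/eqP => [/orP[/eqP->|/eqP->] //|].
by case: (\det M) => [] [|[|k]].
Qed.

(** The map [rho] realises the quotient of Z^m by B Z^m. In the Smith normal form B = L D Q, the
    class of [w] is read off from the residues of the coordinates of L^-1 w modulo the diagonal
    entries d_i, whose product is det B up to sign. *)
Lemma lattice_residue (m : nat) (B : 'M[int]_m) : \det B != 0 ->
  exists (T : finType) (rho : 'cV[int]_m -> T),
    #|T| = absz (\det B) /\
    forall w w', rho w = rho w' -> exists t, w - w' = B *m t.
Proof.
have [L Lu [Q Qu [d _ defB]]] := int_Smith_normal_form B.
have absu (M : 'M[int]_m) : M \in unitmx -> absz (\det M) = 1%N.
  by rewrite unimodularE => /eqP.
pose d_ (i : 'I_m) : int := d`_i.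
set D := \matrix_(i, j) _ in defB.
have detD : \det D = \prod_(i < m) d_ i.
  rewrite det_trig ?mxE; last first.
    apply/is_trig_mxP => i j ij; rewrite mxE.
    by rewrite (ltn_eqF ij) mulr0n.
  by apply: eq_bigr => i _; rewrite mxE eqxx mulr1n.
have detB : absz (\det B) = (\prod_(i < m) absz (d_ i))%N.
  rewrite defB !det_mulmx !abszM (absu _ Lu) (absu _ Qu) mul1n muln1 detD.
  by rewrite (big_morph absz abszM (erefl _)).
rewrite -absz_eq0 -lt0n detB => prodpos.
have dpos (i : 'I_m) : (0 < absz (d_ i))%N.
  by move: prodpos; rewrite (bigD1 i) //= muln_gt0 => /andP[].
pose T := {dffun forall i : 'I_m, 'I_(absz (d_ i))}.
have rP (w : 'cV[int]_m) i : (absz ((invmx L *m w) i ord0 %% d_ i)%Z < absz (d_ i))%N.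
  have d0 : d_ i != 0 by rewrite -absz_eq0 -lt0n dpos.
  have := ltz_mod ((invmx L *m w) i ord0) d0.
  have := modz_ge0 ((invmx L *m w) i ord0) d0.
  by case: (modz _ _) => // k _; rewrite abszE.
pose rho w : T := [ffun i => Ordinal (rP w i)].
exists T, rho; split.
  rewrite card_dep_ffun foldrE big_map big_enum /=.
  by apply: eq_bigr => i _; rewrite card_ord.
move=> w w' /ffunP rr.
have key i : (d_ i %| (invmx L *m (w - w')) i ord0)%Z.
  have d0 : d_ i != 0 by rewrite -absz_eq0 -lt0n dpos.
  have /(congr1 val) /= := rr i; rewrite !ffunE /= => e.
  rewrite mulmxBr !mxE -eqz_mod_dvd; apply/eqP.
  have := modz_ge0 ((invmx L *m w) i ord0) d0.
  have := modz_ge0 ((invmx L *m w') i ord0) d0.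
  move: e; rewrite !mxE.
  by case: (modz _ _) => // a; case: (modz _ _) => // b /= ->.
exists (invmx Q *m \col_i ((invmx L *m (w - w')) i ord0 %/ d_ i)%Z).
rewrite defB -!mulmxA mulKVmx // -[LHS](mulKVmx Lu); congr (_ *m _).
apply/matrixP => i j; rewrite (ord1 j) [RHS]mxE (bigD1 i) //= big1 => [|k]; last first.
  rewrite -val_eqE /= => /negPf ki.
  by rewrite [D _ _]mxE eq_sym ki mulr0n mul0r.
by rewrite addr0 [D _ _]mxE eqxx mulr1n [X in _ * X]mxE mulrC divzK.
Qed.

Lemma ltn_dist_divn (a b d : nat) : (0 < d)%N -> (a %/ d = b %/ d)%N ->
  `|(a%:Z - b%:Z)| < d%:Z.
Proof.
move=> d0 e; rewrite (divn_eq a d) (divn_eq b d) e.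
have := ltn_pmod a d0; have := ltn_pmod b d0; lia.
Qed.

(* Every entry of adj(B) A is a minor of A, so it is at most Delta in absolute
   value.  Hence adj(B) maps the subset sums of the columns in S into a box with
   sides Delta * #|S|; cutting it into cubes of side Delta = |det B|, a subset
   sum is determined by its cube and its class modulo B Z^m. *)
Lemma subset_sum_pigeonhole (m n : nat) (A : 'M[int]_(m, n)) (S : {set 'I_n}) :
  (0 < Delta_m A)%N ->
  (forall u : 'cV[int]_n, A *m u = 0 -> (forall j, absz (u j 0%R) <= 1)%N ->
     (forall j, j \notin S -> u j 0 = 0) -> u = 0) ->
  (2 ^ #|S| <= Delta_m A * #|S|.+1 ^ m)%N.
Proof.
move=> D0 free.
have [g Dg] := Delta_m_attained D0.
set B := colsub g A in Dg.
have B0 : \det B != 0 by rewrite -absz_eq0 -Dg -lt0n.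
have [T [rho [cardT rhoP]]] := lattice_residue B0.
pose ind (V : {set 'I_n}) : 'cV[int]_n := \col_j (j \in V)%:R.
pose Y := \adj B *m A.
have Yle k j : `|Y k j| <= (Delta_m A)%:Z.
  by rewrite /Y adj_mul_colsub -abszE lez_nat minor_le_Delta_m.
(* The shift by max(0, -Y) puts every summand between 0 and Delta, whether or not j lies in V, and
   cancels in differences. The value Delta * #|S| can be reached, so #|S| + 1 cells per coordinate
   are required. *)
pose ht (V : {set 'I_n}) k := \sum_(j in S) (Y k j * (j \in V)%:R + Num.max 0 (- Y k j)).
have htP V k : 0 <= ht V k <= (Delta_m A)%:Z * #|S|%:Z.
  apply/andP; split.
    by apply: sumr_ge0 => j _; case: (j \in V); lia.
  rewrite -[#|S|%:Z]natz mulr_natr -sumr_const; apply: ler_sum => j _.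
  by have := Yle k j; case: (j \in V); lia.
have cellP V k : (absz (ht V k) %/ Delta_m A < #|S|.+1)%N.
  rewrite ltnS -(leq_pmul2r D0) (leq_trans (leq_trunc_div _ _)) //.
  by rewrite -lez_nat PoszM mulrC; have := htP V k; lia.
pose cell V := [ffun k => inord (absz (ht V k) %/ Delta_m A) : 'I_(#|S|.+1)].
pose h V := (rho (A *m ind V), cell V).
suff hinj : {in powerset S &, injective h}.
  have := leq_card_in _ _ hinj.
  by rewrite card_powerset card_prod cardT -Dg card_ffun !card_ord.
move=> V V'; rewrite !inE => VS V'S [rr cc].
have [t et] := rhoP _ _ rr.
have htd k : ht V k - ht V' k = \det B * t k ord0.
  have -> : \det B * t k ord0 = (\adj B *m (B *m t)) k ord0.
    by rewrite mulmxA mul_adj_mx mul_scalar_mx mxE.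
  rewrite -et -mulmxBr mulmxA mxE -sumrB big_mkcond /=; apply: eq_bigr => j _.
  rewrite -/Y !mxE; case: ifPn => [_|jS]; first by lia.
  rewrite (contraNF (subsetP VS j)) // (contraNF (subsetP V'S j)) //.
  by rewrite subrr mulr0.
(* Two heights in the same cell differ by less than Delta, yet they differ by a multiple of det B,
   and |det B| = Delta. *)
have t0 : t = 0.
  apply/matrixP => k l; rewrite (ord1 l) [RHS]mxE {l}.
  have /(congr1 val) := congr1 (fun c : {ffun 'I_m -> 'I_(#|S|.+1)} => c k) cc.
  rewrite !ffunE /= !inordK //.
  move/(ltn_dist_divn D0).
  have [/andP[htV _] /andP[htV' _]] := (htP V k, htP V' k).
  rewrite !gez0_abs // htd Dg abszE normrM -[ltRHS]mulr1 ltr_pM2l ?normr_gt0 //.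
  by move: (t k ord0) => [[|a]|a] //.
have : ind V - ind V' = 0.
  apply: free; first by rewrite mulmxBr et t0 mulmx0.
  - by move=> j; rewrite !mxE; case: (j \in V); case: (j \in V').
  - move=> j jS; rewrite !mxE.
    rewrite (contraNF (subsetP VS j)) // (contraNF (subsetP V'S j)) //.
move/matrixP => e; apply/setP => j; move: (e j ord0); rewrite !mxE.
by case: (j \in V); case: (j \in V').
Qed.

(** * Sparse optimal solutions *)

Definition supp (V : nmodType) (n : nat) (v : 'cV[V]_n) : {set 'I_n} :=
  [set j | v j 0 != 0].

Lemma notin_supp (V : nmodType) (n : nat) (v : 'cV[V]_n) (j : 'I_n) :
  (j \notin supp v) = (v j 0 == 0).
Proof. by rewrite inE negbK. Qed.

Lemma cV_neq0 (V : nmodType) (n : nat) (v : 'cV[V]_n) :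
  v != 0 -> exists j, v j 0 != 0.
Proof.
move=> v_neq0; apply/existsP; apply: contraR v_neq0 => /existsPn none.
by apply/eqP/matrixP => i j; rewrite (ord1 j) mxE; apply/eqP/negPn.
Qed.

(** Well-foundedness of the naturals, used classically so that [P] may be an undecidable property
    such as optimality. *)
Lemma exists_minimal (T : Type) (P : T -> Prop) (f : T -> nat) :
  (exists x, P x) -> exists x, P x /\ forall y, P y -> (f x <= f y)%N.
Proof.
case=> x; have [k] := ubnP (f x); elim: k x => // k IH x fx Px.
have [[y [Py fyx]]|none] := classic (exists y, P y /\ (f y < f x)%N).
  by apply: IH Py; apply: leq_trans fyx _.
exists x; split=> // y Py; rewrite leqNgt; apply/negP => fyx.
by apply: none; exists y.
Qed.

Lemma objD (n : nat) (c z w : 'cV[int]_n) : obj c (z + w) = obj c z + obj c w.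
Proof. by rewrite /obj -big_split; apply: eq_bigr => j _; rewrite mxE mulrDr. Qed.

Lemma objZ (n : nat) (c z : 'cV[int]_n) (a : int) : obj c (a *: z) = a * obj c z.
Proof. by rewrite /obj big_distrr; apply: eq_bigr => j _; rewrite mxE mulrCA. Qed.

Lemma objN (n : nat) (c z : 'cV[int]_n) : obj c (- z) = - obj c z.
Proof. by rewrite -scaleN1r objZ mulN1r. Qed.

(** On feasible points the gap [M - obj c z] is a nonnegative integer, so it attains its minimum. *)
Lemma IP_optimal_exists (m n : nat) (A : 'M[int]_(m, n)) (b : 'cV[int]_m)
  (c : 'cV[int]_n) (M : int) :
  (exists z, IP_feasible A b z) -> (forall z, IP_feasible A b z -> obj c z <= M) ->
  exists z, IP_optimal A b c z.
Proof.
move=> feas bnd.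
have [z [zf zmin]] := exists_minimal (fun z => absz (M - obj c z)) feas.
exists z; split=> // y yf.
by have := zmin y yf; have := bnd y yf; have := bnd z zf; lia.
Qed.

Lemma IP_optimal_move (m n : nat) (A : 'M[int]_(m, n)) (b : 'cV[int]_m)
  (c z u : 'cV[int]_n) :
  IP_optimal A b c z -> A *m u = 0 -> 0 <= obj c u ->
  (forall j, 0 <= (z + u) j 0) -> IP_optimal A b c (z + u).
Proof.
move=> [[z0 Az] zopt] Au cu zu0; split; first by split; rewrite // mulmxDr Az Au addr0.
by move=> y /zopt; rewrite objD; lia.
Qed.

(* If u is a kernel vector with entries in {-1, 0, 1} supported on supp z, then z + u
   and z - u are both feasible, so u is orthogonal to c and z can be moved along u or
   -u until a coordinate vanishes. *)
Lemma IP_optimal_sparse (m n : nat) (A : 'M[int]_(m, n)) (b : 'cV[int]_m)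
  (c : 'cV[int]_n) :
  (exists z, IP_optimal A b c z) ->
  exists z, IP_optimal A b c z /\
    forall u : 'cV[int]_n, A *m u = 0 -> (forall j, absz (u j 0%R) <= 1)%N ->
      (forall j, j \notin supp z -> u j 0 = 0) -> u = 0.
Proof.
case/(exists_minimal (fun z => #|supp z|)) => z [zopt zmin].
exists z; split=> // u Au u1 uz; apply/eqP/negPn/negP => u_neq0.
have [[z0 Az] zbest] := zopt.
have zu_ge0 (v : 'cV[int]_n) j : (absz (v j 0%R) <= 1)%N ->
    (j \notin supp z -> v j 0 = 0) -> 0 <= (z + v) j 0.
  rewrite mxE notin_supp => v1 vz; have := z0 j; have [zj|zj] := eqVneq (z j 0) 0.
    by rewrite zj vz ?zj ?eqxx.
  by move: (z j 0) (v j 0) zj v1 => p q; lia.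
have cu0 : obj c u = 0.
  have := zbest (z + u); have := zbest (z - u); rewrite !objD objN => h1 h2.
  have {h1} : obj c z - obj c u <= obj c z.
    apply: h1; split; last by rewrite mulmxBr Az Au subr0.
    move=> j; apply: zu_ge0; rewrite mxE; first by rewrite abszN.
    by move/uz->; rewrite oppr0.
  have {h2} : obj c z + obj c u <= obj c z; last by lia.
  apply: h2; split; last by rewrite mulmxDr Az Au addr0.
  by move=> j; apply: zu_ge0 => // /uz.
have [v [Av cv v1 vz [i vi]]] : exists v : 'cV[int]_n, [/\ A *m v = 0, obj c v = 0,
    forall j, (absz (v j 0%R) <= 1)%N, forall j, j \notin supp z -> v j 0 = 0
    & exists i, v i 0 < 0].
  have [i ui] := cV_neq0 u_neq0.
  have [ui0|ui0] := ltP (u i 0) 0; first by exists u; split=> //; exists i.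
  exists (- u); split.
  - by rewrite mulmxN Au oppr0.
  - by rewrite objN cu0 oppr0.
  - by move=> j; rewrite mxE abszN.
  - by move=> j jz; rewrite mxE uz ?oppr0.
  - by exists i; rewrite mxE oppr_lt0 lt_def ui ui0.
(* Negative entries of [v] equal -1, so the longest feasible step along [v] is the least z_k over
   these entries, and it makes coordinate [k] vanish. *)
have [k vk kmin] := @Order.TotalTheory.arg_minP _ _ _ i (fun j => v j 0 < 0) (fun j => z j 0) vi.
pose y := z + z k 0 *: v.
have vN1 j : v j 0 < 0 -> v j 0 = -1 by have := v1 j; lia.
have yopt : IP_optimal A b c y.
  apply: IP_optimal_move zopt _ _ _.
  - by rewrite -scalemxAr Av scaler0.
  - by rewrite objZ cv mulr0.
  - move=> j; rewrite 2!mxE; have [vj|vj] := ltP (v j 0) 0.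
      by rewrite vN1 // mulrN1 subr_ge0 kmin.
    by rewrite addr_ge0 ?mulr_ge0.
have := zmin _ yopt; rewrite leqNgt => /negP; apply; apply/proper_card/properP; split.
  apply/subsetP => j; apply: contraLR => jz; rewrite notin_supp /y 2!mxE (vz j jz).
  by move: jz; rewrite notin_supp => /eqP->; rewrite mulr0 addr0.
exists k; first by apply: contraTT vk => /vz->.
by rewrite notin_supp 2!mxE vN1 // mulrN1 subrr.
Qed.

(** * Conformal circuits and proximity *)

(** Column j is the relation that expresses column j of A in the basis B selected by [g], with
    denominators cleared: det(B) e_j minus the sum over k of (adj(B) A)_kj e_(g k). *)
Definition basic_kernel (R : comNzRingType) (m n : nat) (A : 'M[R]_(m, n))
  (g : 'I_m -> 'I_n) : 'M[R]_n :=
  \det (colsub g A) *: 1%:M - colsub g 1%:M *m \adj (colsub g A) *m A.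

Lemma mul_basic_kernel (R : comNzRingType) (m n : nat) (A : 'M[R]_(m, n))
  (g : 'I_m -> 'I_n) : A *m basic_kernel A g = 0.
Proof.
rewrite mulmxBr -scalemxAr mulmx1 !mulmxA -colsubE mul_mx_adj mul_scalar_mx.
exact: subrr.
Qed.

Lemma basic_kernelE (R : comNzRingType) (m n : nat) (A : 'M[R]_(m, n))
  (g : 'I_m -> 'I_n) (i j : 'I_n) :
  basic_kernel A g i j = \det (colsub g A) *+ (i == j) -
    \sum_k (\adj (colsub g A) *m A) k j *+ (i == g k).
Proof.
rewrite /basic_kernel -mulmxA [LHS]mxE [X in X + _]mxE [X in _ * X]mxE mulr_natr.
rewrite [X in _ + X]mxE; congr (_ - _); rewrite mxE; apply: eq_bigr => k _.
by rewrite [colsub _ _ _ _]mxE [1%:M _ _]mxE mulr_natl.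
Qed.

Lemma basic_kernel_nonbasic (R : comNzRingType) (m n : nat) (A : 'M[R]_(m, n))
  (g : 'I_m -> 'I_n) (i j : 'I_n) : (forall k, g k != i) ->
  basic_kernel A g i j = \det (colsub g A) *+ (i == j).
Proof.
move=> gi; rewrite basic_kernelE big1 ?subr0 // => k _.
by rewrite eq_sym (negPf (gi k)).
Qed.

(** The column is a sum of m + 1 multiples of unit vectors, and by [adj_mul_colsub] each coefficient
    is a minor of A up to sign. *)
Lemma basic_kernel_norm (m n : nat) (A : 'M[int]_(m, n)) (g : 'I_m -> 'I_n)
  (j : 'I_n) :
  \sum_i `|basic_kernel A g i j| <= (m.+1 * Delta_m A)%N%:Z.
Proof.
have minor_le k : `|(\adj (colsub g A) *m A) k j| <= (Delta_m A)%:Z.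
  by rewrite adj_mul_colsub -abszE lez_nat minor_le_Delta_m.
apply: (@le_trans _ _ (\sum_i (`|\det (colsub g A)| *+ (i == j) +
    \sum_k `|(\adj (colsub g A) *m A) k j| *+ (i == g k)))).
  apply: ler_sum => i _; rewrite basic_kernelE (le_trans (ler_normB _ _)) //.
  rewrite lerD ?normrMn // (le_trans (ler_norm_sum _ _ _)) //.
  by apply: ler_sum => k _; rewrite normrMn.
have sum_delta (a : int) (l : 'I_n) : \sum_i a *+ (i == l) = a.
  rewrite (bigD1 l) //= eqxx mulr1n big1 ?addr0 // => i /negPf->.
  by rewrite mulr0n.
rewrite big_split /= sum_delta exchange_big /= mulSn PoszD lerD //.
  by rewrite -abszE lez_nat minor_le_Delta_m.
apply: (@le_trans _ _ (\sum_(k < m) (Delta_m A)%:Z)).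
  by apply: ler_sum => k _; rewrite sum_delta.
by rewrite sumr_const card_ord PoszM -[m%:Z]natz mulr_natl.
Qed.

(** Steinitz exchange: take a basis with the fewest indices outside C. If some j in C is missing,
    column j has a nonzero coefficient at a basis index outside C, since otherwise its basic kernel
    vector would be supported on C. Swapping j in keeps the determinant nonzero and lowers the
    count. *)
Lemma basis_extension (m n : nat) (A : 'M[int]_(m, n)) (g0 : 'I_m -> 'I_n)
  (C : {set 'I_n}) : \det (colsub g0 A) != 0 ->
  (forall u : 'cV[int]_n, A *m u = 0 ->
     (forall j, j \notin C -> u j 0 = 0) -> u = 0) ->
  exists g : 'I_m -> 'I_n, \det (colsub g A) != 0 /\
    forall j, j \in C -> exists k, g k = j.
Proof.
move=> det0 indep.
have [g [detg gmin]] := exists_minimal (fun g : 'I_m -> 'I_n =>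
  #|[set k | g k \notin C]|) (ex_intro (fun g => \det (colsub g A) != 0) g0 det0).
exists g; split=> // j jC; apply: NNPP => jg.
have gj k : g k != j by apply/eqP => gk; apply: jg; exists k.
have [k [gk Mkj]] : exists k, g k \notin C /\ (\adj (colsub g A) *m A) k j != 0.
  apply: NNPP => none.
  have /matrixP/(_ j 0) : col j (basic_kernel A g) = 0.
    apply: indep; first by rewrite colE mulmxA mul_basic_kernel mul0mx.
    move=> i iC; rewrite mxE basic_kernelE.
    have -> : (i == j) = false by apply: contraNF iC => /eqP->.
    rewrite mulr0n sub0r big1 ?oppr0 // => k _; case: eqP => // ik.
    apply/eqP/negPn/negP => Mkj; apply: none; exists k.
    by rewrite -ik.
  rewrite [LHS]mxE basic_kernel_nonbasic // eqxx mulr1n mxE => e.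
  by rewrite e eqxx in detg.
have := gmin (replace_col g k j); rewrite -adj_mul_colsub => /(_ Mkj).
rewrite leqNgt => /negP; apply; apply/proper_card/properP; split.
  apply/subsetP => l; rewrite !inE /replace_col; case: eqP => //.
  by rewrite jC.
by exists k; rewrite !inE // /replace_col eqxx jC.
Qed.

Lemma colsub_det_inj (R : comNzRingType) (m n : nat) (A : 'M[R]_(m, n))
  (g : 'I_m -> 'I_n) : \det (colsub g A) != 0 -> injective g.
Proof.
move=> detg k k' e; apply/eqP; apply: contraNT detg => kk'.
rewrite -det_tr; apply/eqP/(determinant_alternate kk') => i.
by rewrite !mxE e.
Qed.

Local Notation toF := (map_mx (intmul 1)).

Lemma kernel_basic_eq0 (F : numFieldType) (m n : nat) (A : 'M[int]_(m, n))
  (g : 'I_m -> 'I_n) (v : 'cV[F]_n) : \det (colsub g A) != 0 ->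
  toF A *m v = 0 -> (forall i, (forall k, g k != i) -> v i 0 = 0) -> v = 0.
Proof.
move=> detg Av vg.
have ginj := colsub_det_inj detg.
have vE : v = colsub g 1%:M *m \col_k v (g k) 0.
  apply/matrixP => i j; rewrite (ord1 j) mxE.
  have [[k gk]|none] := classic (exists k, g k = i).
    rewrite (bigD1 k) //= !mxE gk eqxx mul1r big1 ?addr0 // => l /negPf kl.
    by rewrite !mxE -gk (inj_eq ginj) eq_sym kl mul0r.
  have gi k : g k != i by apply/eqP => gk; apply: none; exists k.
  rewrite vg // big1 // => k _.
  by rewrite !mxE eq_sym (negPf (gi k)) mul0r.
rewrite vE mulmxA -colsubE -map_mxsub in Av.
have Bu : toF (colsub g A) \in @unitmx F m.
  by rewrite unitmxE det_map_mx unitfE intr_eq0.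
by rewrite vE -[\col_k _](mulKmx Bu) Av !mulmx0.
Qed.

(** Signs are compared only on the support of [u], which is thereby contained in that of [v] but may
    be smaller. *)
Definition conformal (F : numDomainType) (n : nat) (u v : 'cV[F]_n) :=
  forall j, u j 0 != 0 -> Num.sg (u j 0) = Num.sg (v j 0).

Lemma conformal_supp (F : numDomainType) (n : nat) (u v : 'cV[F]_n) j :
  conformal u v -> v j 0 = 0 -> u j 0 = 0.
Proof.
move=> uv vj; apply/eqP/negPn/negP => uj; have := uv j uj.
by rewrite vj sgr0 => /eqP; rewrite sgr_eq0 (negPf uj).
Qed.

Lemma conformal_trans (F : numDomainType) (n : nat) (u v w : 'cV[F]_n) :
  conformal u v -> conformal v w -> conformal u w.
Proof.
move=> uv vw j uj; rewrite (uv j uj) vw //.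
by apply: contraNneq uj => /(conformal_supp uv) ->.
Qed.

(** Subtracting at most |y_j| in absolute value may cancel y_j or enlarge it but cannot reverse its
    sign; [v] itself may have any signs. *)
Lemma conformal_sub (F : realDomainType) (n : nat) (y v : 'cV[F]_n) :
  (forall j, `|v j 0| <= `|y j 0|) -> conformal (y - v) y.
Proof.
move=> vy j; have := vy j; rewrite !mxE.
move: (y j 0) (v j 0) => a d; rewrite subr_eq0 ler_norml.
have [a0|a0|->] := ltgtP a 0.
- rewrite ltr0_norm // opprK => /andP[ad _] da.
  by rewrite !ltr0_sg // subr_lt0 lt_def eq_sym da.
- rewrite gtr0_norm // => /andP[_ da] ad.
  by rewrite !gtr0_sg // subr_gt0 lt_def ad.
- by rewrite normr0 oppr0 -eq_le eq_sym => ->.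
Qed.

(** A ratio test: [i] minimises |y_j / v_j| over the support of [v]. Subtracting (y_i / v_i) v from
    [y] then kills coordinate [i] and, by [conformal_sub], creates no sign change. *)
Lemma kill_coordinate (F : realFieldType) (n : nat) (y v : 'cV[F]_n) :
  v != 0 ->
  exists i, v i 0 != 0 /\ forall j, (y j 0 = 0 -> v j 0 = 0) ->
    `|y i 0 / v i 0 * v j 0| <= `|y j 0|.
Proof.
move=> v_neq0.
have [i0 vi0] := cV_neq0 v_neq0.
have [i vi imin] := @Order.TotalTheory.arg_minP _ _ _ i0
  (fun j => v j 0 != 0) (fun j => `|y j 0 / v j 0|) vi0.
exists i; split=> // j yv; have [->|vj] := eqVneq (v j 0) 0.
  by rewrite mulr0 normr0.
by rewrite normrM -ler_pdivlMr ?normr_gt0 // -normf_div imin.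
Qed.

Lemma toF_eq0 (F : numDomainType) (m n : nat) (M : 'M[int]_(m, n)) :
  (toF M == 0 :> 'M[F]_(m, n)) = (M == 0).
Proof.
apply/eqP/eqP => [/matrixP M0|->]; last exact: map_mx0.
apply/matrixP => i j; have := M0 i j; rewrite !mxE => /eqP.
by rewrite intr_eq0 => /eqP.
Qed.

(* A kernel vector y' conformal to y of minimal support is unique up to scaling among
   kernel vectors supported on supp y'.  Removing one index j0 from its support leaves
   independent columns, which extend to a basis; y' is then proportional to the
   integral kernel vector that expresses column j0 in this basis. *)
Lemma conformal_circuit (F : realFieldType) (m n : nat) (A : 'M[int]_(m, n))
  (g0 : 'I_m -> 'I_n) (y : 'cV[F]_n) : \det (colsub g0 A) != 0 ->
  toF A *m y = 0 -> y != 0 ->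
  exists u : 'cV[int]_n, [/\ A *m u = 0, u != 0, conformal (toF u) y &
    \sum_j `|u j 0| <= (m.+1 * Delta_m A)%N%:Z].
Proof.
move=> det0 Ay y_neq0.
have [y' [[Ay' y'_neq0 y'y] y'min]] := exists_minimal (fun v => #|supp v|)
  (ex_intro (fun v : 'cV[F]_n => [/\ toF A *m v = 0, v != 0 & conformal v y])
    y (And3 Ay y_neq0 (fun j _ => erefl))).
have [j0 y'j0] := cV_neq0 y'_neq0.
have indep (u : 'cV[int]_n) : A *m u = 0 ->
    (forall j, j \notin supp y' :\ j0 -> u j 0 = 0) -> u = 0.
  move=> Au uy'; apply/eqP/negPn/negP => u_neq0.
  have toFu_neq0 : toF u != 0 :> 'cV[F]_n by rewrite toF_eq0.
  have yu j : y' j 0 = 0 -> (toF u : 'cV[F]_n) j 0 = 0.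
    by move=> y'j; rewrite mxE uy' // !inE y'j eqxx andbF.
  have [i [ui ile]] := kill_coordinate y' toFu_neq0.
  pose w := y' - (y' i 0 / (toF u : 'cV[F]_n) i 0) *: toF u.
  have wy' : conformal w y'.
    by apply: conformal_sub => j; rewrite mxE; apply/ile/yu.
  have wmin : (#|supp y'| <= #|supp w|)%N.
    apply: y'min; split; last exact: conformal_trans wy' y'y.
      by rewrite mulmxBr Ay' -scalemxAr -map_mxM Au map_mx0 scaler0 subr0.
    have wj0 : w j0 0 = y' j0 0.
      rewrite [LHS]mxE [X in _ + X]mxE [X in _ - X]mxE [X in _ * X]mxE uy'.
        by rewrite mulr0 subr0.
      by rewrite !inE eqxx.
    by apply: contraNneq y'j0 => w0; rewrite -wj0 w0 mxE.
  move: wmin; rewrite leqNgt => /negP; apply; apply/proper_card/properP; split.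
    apply/subsetP => j; apply: contraLR; rewrite !notin_supp => /eqP y'j.
    by rewrite (conformal_supp wy' y'j).
  exists i; first by rewrite inE; apply: contraNneq ui => /yu->.
  by rewrite notin_supp /w [X in X == _]mxE [X in _ + X]mxE [X in _ - X]mxE divfK // subrr.
have [g [detg gC]] := basis_extension det0 indep.
have off_basis i : i != j0 -> (forall k, g k != i) -> y' i 0 = 0.
  move=> ij0 gi; apply/eqP/negPn/negP => y'i.
  have [|k gk] := gC i; first by rewrite !inE ij0.
  by have := gi k; rewrite gk eqxx.
(* If [j0] were a basis index, [y'] would be a kernel vector supported on the basis, hence zero. *)
have gj0 k : g k != j0.
  apply: contraNneq y'_neq0 => gk; apply/eqP.
  apply: (kernel_basic_eq0 detg Ay') => i gi; apply: off_basis => //.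
  by apply: contraTneq (gi k) => ->; rewrite gk eqxx.
pose d : F := (\det (colsub g A))%:~R.
have d0 : d != 0 by rewrite intr_eq0.
pose u0 := col j0 (basic_kernel A g).
have Au0 : A *m u0 = 0 by rewrite /u0 colE mulmxA mul_basic_kernel mul0mx.
have u0y' : toF u0 = (d / y' j0 0) *: y'.
  apply/eqP; rewrite -subr_eq0; apply/eqP; apply: (kernel_basic_eq0 detg).
    by rewrite mulmxBr -map_mxM Au0 map_mx0 -scalemxAr Ay' scaler0 subr0.
  move=> i gi; rewrite [LHS]mxE [X in X + _]mxE [X in X%:~R + _]mxE.
  rewrite [X in _ + X]mxE [X in _ - X]mxE basic_kernel_nonbasic //.
  have [->|ij0] := eqVneq i j0; first by rewrite divfK // mulr1n subrr.
  by rewrite mulr0n (off_basis i) // mulr0 subr0.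
have u0_neq0 : u0 != 0.
  rewrite -(toF_eq0 F) u0y' scaler_eq0 negb_or y'_neq0.
  by rewrite mulf_neq0 // invr_neq0.
have u0norm : \sum_j `|u0 j 0| <= (m.+1 * Delta_m A)%N%:Z.
  apply: le_trans (basic_kernel_norm A g j0).
  by apply: ler_sum => i _; rewrite mxE.
have scale_conformal (a : F) : 0 < a -> conformal (a *: y') y.
  move=> a0; apply: conformal_trans y'y => j.
  by rewrite mxE sgrM gtr0_sg // mul1r.
have [pos|neg|eq0] := ltgtP 0 (d / y' j0 0).
- by exists u0; split=> //; rewrite u0y'; apply: scale_conformal.
- exists (- u0); split.
  + by rewrite mulmxN Au0 oppr0.
  + by rewrite oppr_eq0.
  + by rewrite map_mxN u0y' -scaleNr; apply: scale_conformal; rewrite oppr_gt0.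
  + by rewrite (eq_bigr (fun j => `|u0 j 0|)) // => j _; rewrite mxE normrN.
- by move: d0; rewrite -(divfK y'j0 d) -eq0 mul0r eqxx.
Qed.

Lemma norm_sub_conformal (F : realDomainType) (a d : F) :
  (d != 0 -> Num.sg d = Num.sg a) -> `|d| <= `|a| -> `|a - d| = `|a| - `|d|.
Proof.
have [->|d0] := eqVneq d 0; first by rewrite normr0 !subr0.
move=> /(_ isT); have [a0|a0|->] := ltgtP a 0.
- rewrite (ltr0_sg a0) => /eqP; rewrite sgr_cp0 => d_lt0.
  by rewrite (ltr0_norm a0) (ltr0_norm d_lt0) lerN2 => ad; rewrite ler0_norm ?subr_le0 ?opprD.
- rewrite (gtr0_sg a0) => /eqP; rewrite sgr_cp0 => d_gt0.
  by rewrite (gtr0_norm a0) (gtr0_norm d_gt0) => ad; rewrite ger0_norm ?subr_ge0.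
- by rewrite sgr0 => /eqP; rewrite sgr_eq0 (negPf d0).
Qed.

(* Peeling off conformal circuits one at a time: each of them has a coefficient less
   than 1 by tightness, and each of them uses up one index of N. *)
Lemma conformal_norm_bound (F : realFieldType) (m n : nat) (A : 'M[int]_(m, n))
  (g0 : 'I_m -> 'I_n) (y0 : 'cV[F]_n) : \det (colsub g0 A) != 0 ->
  (forall u : 'cV[int]_n, A *m u = 0 -> u != 0 -> conformal (toF u) y0 ->
     ~ forall j, `|(toF u : 'cV[F]_n) j 0| <= `|y0 j 0|) ->
  forall (N : {set 'I_n}) (y : 'cV[F]_n),
    (forall v : 'cV[F]_n, toF A *m v = 0 -> (forall j, y j 0 = 0 -> v j 0 = 0) ->
       (forall j, j \in N -> v j 0 = 0) -> v = 0) ->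
    toF A *m y = 0 -> conformal y y0 -> (forall j, `|y j 0| <= `|y0 j 0|) ->
    y = 0 \/ \sum_j `|y j 0| < (#|N| * (m.+1 * Delta_m A))%N%:R.
Proof.
move=> det0 tight N; have [k] := ubnP #|N|.
elim: k N => // k IH N Nk y yN Ay yy0 yle.
have [->|y_neq0] := eqVneq y 0; [by left | right].
have [u [Au u_neq0 uy unorm]] := conformal_circuit det0 Ay y_neq0.
pose v : 'cV[F]_n := toF u.
have v_neq0 : v != 0 by rewrite toF_eq0.
have Av : toF A *m v = 0 by rewrite -map_mxM Au map_mx0.
have yv j : y j 0 = 0 -> v j 0 = 0 by apply: conformal_supp.
have [i [vi ile]] := kill_coordinate y v_neq0.
pose l := y i 0 / v i 0.
have l0 : 0 < l.
  rewrite -sgr_gt0 /l sgrM sgrV -(uy i vi) -expr2 sqr_sg.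
  by rewrite vi.
have l1 : l < 1.
  rewrite ltNge; apply/negP => l1; apply: (tight u) => // [|j].
    exact: conformal_trans uy yy0.
  apply: le_trans (yle j); apply: le_trans (ile j (yv j)).
  by rewrite normrM ler_peMl // gtr0_norm.
pose y' := y - l *: v.
have y'norm j : `|y' j 0| = `|y j 0| - l * `|v j 0|.
  rewrite -[l in RHS]gtr0_norm // -normrM -norm_sub_conformal.
  - by rewrite 3!mxE.
  - move=> lv; rewrite sgrM gtr0_sg // mul1r uy //.
    by apply: contraNneq lv => e; rewrite /v e mulr0.
  - exact/ile/yv.
have y'y : conformal y' y.
  by apply: conformal_sub => j; rewrite mxE; apply/ile/yv.
have y'i : y' i 0 = 0.
  rewrite [LHS]mxE [X in _ + X]mxE [X in _ - X]mxE.
  by rewrite divfK ?subrr.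
(* The coordinates in [N] determine every kernel vector supported on supp y. On supp y' this space
   is smaller, as it loses [v], so some index of [N] can be spared. *)
have [p [pN y'N]] : exists p, p \in N /\ forall w : 'cV[F]_n, toF A *m w = 0 ->
    (forall j, y' j 0 = 0 -> w j 0 = 0) -> (forall j, j \in N :\ p -> w j 0 = 0) ->
    w = 0.
  apply: NNPP => none.
  have /fin_all_exists[w wP] : forall p, exists w : 'cV[F]_n, p \in N ->
      [/\ toF A *m w = 0, forall j, y' j 0 = 0 -> w j 0 = 0,
          forall j, j \in N :\ p -> w j 0 = 0 & w p 0 != 0].
    move=> p; apply: NNPP => now; apply: none; exists p.
    have pN : p \in N by apply: contraPT (now) => pN []; exists 0 => /(negP pN).
    split=> // w Aw wy' wN; apply: yN => // [j yj|j jN].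
      exact/wy'/(conformal_supp y'y).
    have [->|jp] := eqVneq j p; last by rewrite wN // !inE jp.
    by apply/eqP/negPn/negP => wp; apply: now; exists w.
  (* The vectors w p are dual to the coordinates in N, so they would span v. *)
  have vE : v = \sum_(p in N) (v p 0 / w p p 0) *: w p.
    apply/eqP; rewrite -subr_eq0; apply/eqP; apply: yN.
    - rewrite mulmxBr Av sub0r mulmx_sumr big1 ?oppr0 // => p /wP[Aw _ _ _].
      by rewrite -scalemxAr Aw scaler0.
    - move=> j yj; rewrite [LHS]mxE yv // add0r mxE summxE big1 ?oppr0 // => p pN.
      have [_ wy' _ _] := wP p pN.
      by rewrite mxE (wy' j) ?mulr0 //; apply: conformal_supp y'y yj.
    - move=> j jN; rewrite [LHS]mxE [X in _ + X]mxE summxE (bigD1 j) //= big1.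
        by have [_ _ _ wj] := wP j jN; rewrite addr0 [X in _ - X]mxE divfK ?subrr.
      move=> p /andP[pN pj]; have [_ _ wN _] := wP p pN.
      by rewrite mxE (wN j) ?mulr0 // !inE eq_sym pj jN.
  (* Every [w p] vanishes at [i], because [y'] does, whereas v_i is nonzero. *)
  move: vi; rewrite vE summxE big1 ?eqxx // => p pN.
  have [_ wy' _ _] := wP p pN.
  by rewrite mxE (wy' i) ?mulr0.
have N'k : (#|N :\ p| < k)%N by rewrite (cardsD1 p) pN in Nk.
have y'bnd : \sum_j `|y' j 0| <= (#|N :\ p| * (m.+1 * Delta_m A))%N%:R.
  have Ay' : toF A *m y' = 0 by rewrite mulmxBr Ay -scalemxAr Av scaler0 subr0.
  have y'le j : `|y' j 0| <= `|y0 j 0|.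
    by rewrite (le_trans _ (yle j)) // y'norm gerBl mulr_ge0 // ltW.
  have [->|/ltW//] := IH _ N'k y' y'N Ay' (conformal_trans y'y yy0) y'le.
  by rewrite big1 ?ler0n // => j _; rewrite mxE normr0.
have -> : \sum_j `|y j 0| = l * \sum_j `|v j 0| + \sum_j `|y' j 0|.
  rewrite mulr_sumr -big_split; apply: eq_bigr => j _ /=.
  by rewrite y'norm addrC subrK.
have v_gt0 : 0 < \sum_j `|v j 0|.
  rewrite (bigD1 i) //= ltr_wpDr ?normr_gt0 //.
  by apply: sumr_ge0.
rewrite (cardsD1 p) pN add1n mulSn natrD ltr_leD //.
apply: (@lt_le_trans _ _ (\sum_j `|v j 0|)); first by rewrite gtr_pMl.
have -> : \sum_j `|v j 0| = (\sum_j `|u j 0|)%:~R.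
  by rewrite rmorph_sum; apply: eq_bigr => j _; rewrite mxE -intr_norm.
by rewrite -(ler_int F) in unorm.
Qed.

(** The last two hypotheses on [x] are the kernel forms of being a vertex (independent columns on
    supp x) and of LP optimality (no improving feasible direction). *)
Lemma proximity (F : archiRealFieldType) (m n : nat) (A : 'M[int]_(m, n))
  (b : 'cV[int]_m) (c : 'cV[int]_n) (x : 'cV[F]_n) :
  (0 < Delta_m A)%N ->
  (exists z, IP_optimal A b c z) ->
  (forall j, 0 <= x j 0) -> toF A *m x = toF b ->
  (forall v : 'cV[F]_n, toF A *m v = 0 -> (forall j, x j 0 = 0 -> v j 0 = 0) ->
     v = 0) ->
  (forall v : 'cV[F]_n, toF A *m v = 0 -> (forall j, v j 0 < 0 -> 0 < x j 0) ->
     \sum_j (c j 0)%:~R * v j 0 <= 0) ->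
  exists (z : 'cV[int]_n) (s : nat),
    [/\ IP_optimal A b c z, (2 ^ s <= Delta_m A * s.+1 ^ m)%N &
        toF z = x \/
        \sum_j `|(z j 0)%:~R - x j 0| < (s * (m.+1 * Delta_m A))%N%:R].
Proof.
move=> D0 optex x0 Ax vertex lpopt.
have [g0 Dg0] := Delta_m_attained D0.
have det0 : \det (colsub g0 A) != 0 by rewrite -absz_eq0 -Dg0 -lt0n.
have [z0 [z0opt z0sparse]] := IP_optimal_sparse optex.
pose dist (z : 'cV[int]_n) : F := \sum_j `|(z j 0)%:~R - x j 0|.
have dist_ge0 z : 0 <= dist z by apply: sumr_ge0.
pose near z := IP_optimal A b c z /\
  forall j, z0 j 0 = 0 -> x j 0 = 0 -> z j 0 = 0.
(* Minimising the integer part of the distance suffices: subtracting a nonzero integral conformal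
   vector shortens the distance by at least 1. *)
have [z [[zopt znear] zmin]] := exists_minimal (fun z => Num.truncn (dist z))
  (ex_intro near z0 (conj z0opt (fun j z0j _ => z0j))).
exists z, #|supp z0|; split=> //; first exact: subset_sum_pigeonhole.
pose y : 'cV[F]_n := toF z - x.
have yE j : y j 0 = (z j 0)%:~R - x j 0 by rewrite !mxE.
have [[z_ge0 Az] _] := zopt.
have Ay : toF A *m y = 0 by rewrite mulmxBr -map_mxM Az Ax subrr.
have [||/eqP|] := @conformal_norm_bound F m n A g0 y det0 _ (supp z0) y _ Ay
    (fun _ _ => erefl) (fun _ => lexx _).
- move=> u Au u_neq0 uy ule.
  have uneg j : (u j 0 < 0) -> (z j 0)%:~R < x j 0.
    move=> uj; have := uy j; rewrite yE mxE intr_eq0 lt_eqF // => /(_ isT).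
    by rewrite ltr0_sg ?ltrz0 // => /esym/eqP; rewrite sgr_cp0 subr_lt0.
  (* Where u_j < 0, conformality gives x_j > z_j >= 0, so [u] is a feasible direction of the linear
     program at [x]. Hence z - u is no worse than z. *)
  have cu : obj c u <= 0.
    rewrite -(ler_int F) rmorph_sum /=.
    rewrite (eq_bigr (fun j => (c j 0)%:~R * (toF u : 'cV[F]_n) j 0)); last first.
      by move=> j _; rewrite rmorphM mxE.
    apply: lpopt => [|j]; first by rewrite -map_mxM Au map_mx0.
    rewrite mxE ltrz0 => /uneg; apply: le_lt_trans.
    by rewrite ler0z.
  have norm_sub j : `|((z - u) j 0)%:~R - x j 0| = `|(z j 0)%:~R - x j 0| - `|(u j 0)%:~R|.
    rewrite !mxE rmorphB addrAC norm_sub_conformal //=.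
      by have := uy j; rewrite yE mxE.
    by have := ule j; rewrite yE mxE.
  have near_zu : near (z - u).
    split.
      apply: IP_optimal_move zopt _ _ _; rewrite ?mulmxN ?Au ?oppr0 ?objN ?oppr_ge0 //.
      move=> j; have := z_ge0 j; rewrite !mxE => zj.
      have [uj|uj] := leP (u j 0) 0; first by rewrite addr_ge0 ?oppr_ge0.
      rewrite -(ler_int F) rmorphB subr_ge0 /=.
      have := uy j; rewrite yE mxE intr_eq0 gt_eqF // => /(_ isT).
      rewrite gtr0_sg ?ltr0z // => /esym/eqP; rewrite sgr_cp0 => zx.
      have := ule j; rewrite yE mxE (gtr0_norm zx) gtr0_norm ?ltr0z // => h.
      by rewrite (le_trans h) // gerBl.
    move=> j z0j xj; have zj := znear j z0j xj; rewrite !mxE zj sub0r.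
    have := ule j; rewrite yE zj xj subrr normr0 mxE normr_le0 intr_eq0.
    by move/eqP->; rewrite oppr0.
  have := zmin _ near_zu; apply/negP; rewrite -ltnNge -ltnS.
  have dist_zu : dist (z - u) <= dist z - 1.
    rewrite /dist (eq_bigr _ (fun j _ => norm_sub j)) sumrB lerD2l lerN2.
    have [i ui] := cV_neq0 u_neq0.
    rewrite (bigD1 i) //= ler_wpDr ?sumr_ge0 //.
    by rewrite -intr_norm ler1z -gtz0_ge1 normr_gt0.
  rewrite ltnS truncn_ge_nat // -natr1.
  rewrite -lerBrDr (le_trans _ dist_zu) //.
  by rewrite -truncn_ge_nat.
(* Here [N] is supp z0. Outside supp z0 and supp x both [z] and [x] vanish, so a kernel vector that
   is zero on supp z0 and wherever z = x lives on supp x. *)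
- move=> v Av vy vz0; apply: vertex => // j xj.
  have [z0j|z0j] := eqVneq (z0 j 0) 0; last by rewrite vz0 // inE.
  by apply: vy; rewrite yE znear // xj subrr.
- by rewrite subr_eq0 => /eqP; left.
by move=> h; right; rewrite (eq_bigr _ (fun j _ => congr1 _ (esym (yE j)))).
Qed.

(** * The numerical estimate *)

(** After taking logarithms this bounds ln(s + 1) linearly in s for the case m = 1; the fourth power
    below serves m = 2. *)
Lemma cube_le_exp2 (s : nat) : ((s.+1 ^ 3) <= 8 * 2 ^ s)%N.
Proof.
do 4 (case: s => [//|s]); elim: s => // s; rewrite (expnS 2 s.+4) mulnCA; nia.
Qed.

Lemma fourth_power_le_exp2 (s : nat) : ((s.+1 ^ 4) <= 64 * 2 ^ s)%N.
Proof.
do 5 (case: s => [//|s]); elim: s => // s; rewrite (expnS 2 s.+4.+1) mulnCA; nia.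
Qed.

Local Open Scope R_scope.

Lemma ln_le_sub1 (x : R) : 0 < x -> ln x <= x - 1.
Proof. by move=> x0; have := exp_ineq1_le (ln x); rewrite exp_ln //; Lra.lra. Qed.

Lemma ln_pow_INR (x : R) (k : nat) : 0 < x -> ln (pow x k) = INR k * ln x.
Proof. by move=> x0; rewrite -Rpower_pow // /Rpower ln_exp. Qed.

Lemma ln_le (x y : R) : 0 < x -> x <= y -> ln x <= ln y.
Proof. by move=> x0 [xy|->]; [left; apply: ln_increasing | right]. Qed.

Lemma ln_le_tangent (x q : R) : 0 < x -> 0 < q -> ln x <= ln q + x / q - 1.
Proof.
move=> x0 q0; have := @ln_le_sub1 (x / q) (Rdiv_lt_0_compat _ _ x0 q0).
rewrite ln_mult ?ln_Rinv //; [Lra.lra | exact: Rinv_0_lt_compat].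
Qed.

(** Both bounds come from (51/50)^35 <= 2 <= (51/50)^36 and 1/51 <= ln(51/50) <= 1/50. *)
Lemma ln2_bounds : (35 / 51 <= ln 2 <= 36 / 50).
Proof.
have h1 : ln (51 / 50) <= 51 / 50 - 1 by apply: ln_le_sub1; Lra.lra.
have h2 : ln (50 / 51) <= 50 / 51 - 1 by apply: ln_le_sub1; Lra.lra.
have e : (ln (50 / 51) = - ln (51 / 50)).
  by rewrite -ln_Rinv ?Rinv_div; Lra.lra.
have p1 : (ln (pow (51 / 50) 35) <= ln 2).
  by apply: ln_le; Lra.lra.
have p2 : (ln 2 <= ln (pow (51 / 50) 36)).
  by apply: ln_le; Lra.lra.
rewrite !ln_pow_INR /= in p1 p2; Lra.lra.
Qed.

Lemma INR_expn (a k : nat) : INR (a ^ k)%N = pow (INR a) k.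
Proof. by rewrite !INRE natrX RpowE. Qed.

Lemma ln_INR_pow_le (p q i j l : nat) : (0 < p)%N -> (0 < q)%N -> (0 < l)%N ->
  (p ^ i <= l * q ^ j)%N -> INR i * ln (INR p) <= ln (INR l) + INR j * ln (INR q).
Proof.
move=> p0 q0 l0 /ssrnat.leP/le_INR.
have pos a : (0 < a)%N -> 0 < INR a by move/ssrnat.ltP/lt_0_INR.
rewrite mult_INR !INR_expn => h.
rewrite -(ln_pow_INR i (pos p p0)) -(ln_pow_INR j (pos q q0)).
have qj : 0 < pow (INR q) j by apply/pow_lt/pos.
rewrite -(ln_mult _ _ (pos l l0) qj).
by apply: ln_le h; apply/pow_lt/pos.
Qed.

(* For m >= 4 only half of the bound ln D >= s ln 2 - m ln (s + 1) is used, so that the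
   terms in ln m cancel.  For m <= 3 it is used in full; the estimate for m = 1 is tight
   at s = 3 and would fail for some real s between 3 and 4. *)
Lemma sparsity_estimate (m s D : nat) : (0 < m)%N -> (0 < D)%N ->
  (2 ^ s <= D * s.+1 ^ m)%N ->
  INR s * (INR m + 1) * ln 2 <=
    3 * INR m ^ 2 * ln 2 + 3 / 2 * INR m ^ 2 * ln (INR m) + 3 * INR m * ln (INR D).
Proof.
move=> m0 D0 hs.
have [l2_ge l2_le] := ln2_bounds.
have lnD : 0 <= ln (INR D).
  by rewrite -ln_1; apply: ln_le; [Lra.lra | apply: (le_INR 1); apply/ssrnat.leP].
have s0 := pos_INR s.
have h : INR s * ln 2 <= ln (INR D) + INR m * ln (INR s + 1).
  by rewrite -S_INR; apply: (@ln_INR_pow_le 2).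
have s1 : 0 < INR s + 1 by Lra.lra.
have i1 : INR 1 = 1 by exact: INR_IZR_INZ.
have i2 : INR 2 = 2 by exact: INR_IZR_INZ.
have i3 : INR 3 = 3 by exact: INR_IZR_INZ.
have i4 : INR 4 = 4 by exact: INR_IZR_INZ.
have i6 : INR 6 = 6 by exact: INR_IZR_INZ.
have ln8 : ln (INR 8) = 3 * ln 2.
  have -> : INR 8 = pow 2 3 by rewrite (INR_IZR_INZ 8) /=; Lra.lra.
  by rewrite ln_pow_INR ?i3; Lra.lra.
have [m4|] := leqP 4 m; last first.
  case: m m0 h {hs} => [|[|[|[|//]]]] // _; rewrite ?i1 ?i2 ?i3 => h _.
  - have := @ln_INR_pow_le s.+1 2 3 s 8 isT isT isT (cube_le_exp2 s).
    rewrite (S_INR s) i3 i2 ln8 ln_1; Lra.lra.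
  - have := @ln_INR_pow_le s.+1 2 4 s 64 isT isT isT (fourth_power_le_exp2 s).
    have -> : INR 64 = pow 2 6 by rewrite (INR_IZR_INZ 64) /=; Lra.lra.
    rewrite (S_INR s) ln_pow_INR ?i6 ?i4 ?i2; Lra.lra.
  (* For m = 3: 2^11 <= 3^7 bounds ln 3 from below, and ln(s + 1) is replaced by its tangent at
     8. *)
  - have := @ln_INR_pow_le 2 3 11 7 1 isT isT isT isT.
    have := @ln_le_tangent (INR s + 1) (INR 8) s1 (lt_0_INR 8 (@ssrnat.ltP 0 8 isT)).
    rewrite ln8 i1 i2 i3 ln_1 (INR_IZR_INZ 8) (INR_IZR_INZ 7) (INR_IZR_INZ 11) /=.
    move=> h1 h2; have : INR s * (35 / 51) <= INR s * ln 2.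
      exact: Rmult_le_compat_l.
    Lra.lra.
have mR : 4 <= INR m by rewrite -i4; apply/le_INR/ssrnat.leP.
have ln9 : 5 * ln 9 <= 16 * ln 2.
  have := @ln_INR_pow_le 3 2 5 8 1 isT isT isT isT.
  have -> : 9 = pow 3 2 by rewrite /=; Lra.lra.
  rewrite ln_pow_INR ?i1 ?i2 ?i3 ?ln_1 ?(INR_IZR_INZ 5) ?(INR_IZR_INZ 8) /=; Lra.lra.
(* The tangent at 9m produces ln m, and multiplied by (3/2) m^2 this is exactly the logarithmic term
   of the goal. *)
have tangent : ln (INR s + 1) <= ln 9 + ln (INR m) + (INR s + 1) / (9 * INR m) - 1.
  by rewrite -ln_mult; try Lra.lra; apply: ln_le_tangent; Lra.lra.
set x := INR m in h tangent mR *; set t := INR s in s0 h tangent s1 *.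
set y := ln (t + 1) in h tangent; set a := ln (INR D) in lnD h *.
set z := ln x in tangent *.
have tangent' : x * x * y <= x * x * (16 / 5 * ln 2 + z - 1) + x * (t + 1) / 9.
  have -> : x * (t + 1) / 9 = x * x * ((t + 1) / (9 * x)) by field_simplify_eq; Lra.lra.
  by rewrite -Rmult_plus_distr_l; apply: Rmult_le_compat_l; Lra.nra.
have hx : x * (t * ln 2) <= x * (a + x * y) by apply: Rmult_le_compat_l; Lra.lra.
have xa : 0 <= x * a by apply: Rmult_le_pos; Lra.lra.
(* With [hx] taken 3/2 times, (x/2 - 1) t ln 2 is left over; it absorbs the slope term x t / 6 of
   the tangent. The terms free of t are settled by [xx]. *)
have xt : x * t / 6 <= (x / 2 - 1) * t * ln 2.
  have : (x / 2 - 1) * t * (35 / 51) <= (x / 2 - 1) * t * ln 2.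
    by apply: Rmult_le_compat_l => //; apply: Rmult_le_pos; Lra.lra.
  have := Rmult_le_compat_r t _ _ s0 mR; Lra.lra.
have xx : 9 / 5 * (x * x * ln 2) + x / 6 <= 3 / 2 * (x * x).
  have : x * x * ln 2 <= x * x * (36 / 50) by apply: Rmult_le_compat_l; Lra.nra.
  Lra.nra.
Lra.lra.
Qed.

Lemma bound_estimate (m s D H : nat) : (0 < m)%N -> (0 < D)%N -> (0 < H)%N ->
  (2 ^ s <= D * s.+1 ^ m)%N -> INR D <= gamma_m m * INR H ^ m ->
  let bound := 3 * INR m ^ 2 *
    log2 (2 * sqrt (2 * INR m * log2 (INR m + 1)) * INR H) * gamma_m m * INR H ^ m in
  0 < bound /\ INR (s * (m.+1 * D)) <= bound.
Proof.
move=> m0 D0 H0 hs hD bound.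
have i2 : INR 2 = 2 by exact: INR_IZR_INZ.
have [l2_ge l2_le] := ln2_bounds.
have one_le k : (0 < k)%N -> 1 <= INR k by move=> /ssrnat.leP/(le_INR 1).
have m1 := one_le m m0; have D1 := one_le D D0; have H1 := one_le H H0.
have Hm : 0 < INR H ^ m by apply: pow_lt; Lra.lra.
pose lg := log2 (INR m + 1).
have lg0 : 0 < lg.
  apply: Rdiv_lt_0_compat; last by rewrite i2; Lra.lra.
  by rewrite -ln_1; apply: ln_increasing; Lra.lra.
have rad0 : 0 < 2 * INR m * lg by apply: Rmult_lt_0_compat; Lra.lra.
have gm0 : 0 < gamma_m m by apply: exp_pos.
pose P := gamma_m m * INR H ^ m.
have lnP : ln P = INR m / 2 * ln (2 * lg) + INR m * ln (INR H).
  by rewrite /P (ln_mult (gamma_m m)) // ln_pow_INR ?ln_exp ?i2 //; Lra.lra.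
have lnDP : ln (INR D) <= ln P by apply: ln_le hD; Lra.lra.
have lnD : 0 <= ln (INR D) by rewrite -ln_1; apply: ln_le; Lra.lra.
have lnm : 0 <= ln (INR m) by rewrite -ln_1; apply: ln_le; Lra.lra.
have sqrt0 : 0 < sqrt (2 * INR m * lg) by apply: sqrt_lt_R0.
have lnsqrt : 2 * ln (sqrt (2 * INR m * lg)) = ln (INR m) + ln (2 * lg).
  rewrite -ln_mult; try Lra.lra.
  have -> : INR m * (2 * lg) = sqrt (2 * INR m * lg) * sqrt (2 * INR m * lg).
    by rewrite sqrt_sqrt; Lra.lra.
  by rewrite ln_mult //; Lra.lra.
(* Since P = gamma_m H^m, the factor m turns the logarithm in the bound into the right side of
   [sparsity_estimate] with P in place of D, up to the factor 3m. *)
have key : INR m * ln (2 * sqrt (2 * INR m * lg) * INR H) =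
    INR m * ln 2 + INR m * ln (INR m) / 2 + ln P.
  have -> : ln (2 * sqrt (2 * INR m * lg) * INR H) =
      ln 2 + (ln (INR m) + ln (2 * lg)) / 2 + ln (INR H).
    by rewrite -lnsqrt (ln_mult (2 * _)) ?(ln_mult 2) //; Lra.lra.
  by rewrite lnP; Lra.lra.
have est := sparsity_estimate m0 D0 hs.
pose Q := 3 * INR m ^ 2 * ln 2 + 3 / 2 * INR m ^ 2 * ln (INR m) + 3 * INR m * ln P.
have boundE : bound = Q / ln 2 * P.
  rewrite /bound -/lg [X in 3 * _ * X]/log2 i2 /Q /P.
  have -> : 3 * INR m ^ 2 * ln 2 + 3 / 2 * INR m ^ 2 * ln (INR m) + 3 * INR m * ln P
    = 3 * INR m * (INR m * ln (2 * sqrt (2 * INR m * lg) * INR H)).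
    by rewrite key /=; Lra.lra.
  by rewrite /= /Rdiv; Lra.lra.
have mlnD := Rmult_le_compat_l (3 * INR m) _ _ ltac:(Lra.lra) lnDP.
have l20 : 0 < ln 2 by Lra.lra.
have m2 : 0 < INR m ^ 2 by apply: pow_lt; Lra.lra.
have Q0 : 0 < Q.
  have := Rmult_lt_0_compat _ _ m2 l20.
  have := Rmult_le_pos _ _ (Rlt_le _ _ m2) lnm.
  have := Rmult_le_pos (3 * INR m) _ ltac:(Lra.lra) lnD.
  by rewrite /Q; Lra.lra.
have P0 : 0 < P by apply: Rmult_lt_0_compat.
have Ql : 0 < Q / ln 2 by apply: Rdiv_lt_0_compat; Lra.lra.
split; first by rewrite boundE; apply: Rmult_lt_0_compat.
rewrite boundE 2!mult_INR -Rmult_assoc S_INR.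
apply: Rmult_le_compat => //; try Lra.lra.
  by apply: Rmult_le_pos; [exact: pos_INR | Lra.lra].
apply: (Rmult_le_reg_r (ln 2)); first by Lra.lra.
have -> : Q / ln 2 * ln 2 = Q by rewrite /Rdiv Rmult_assoc Rinv_l; Lra.lra.
by rewrite /Q; Lra.lra.
Qed.

Local Close Scope R_scope.

(** * Linear programs over the reals *)

Lemma int2RE (a : int) : int2R a = a%:~R :> R.
Proof. by case: a => k; rewrite /int2R INRE // NegzE rmorphN. Qed.

Lemma LP_feasibleE (m n : nat) (A : 'M[int]_(m, n)) (b : 'cV[int]_m) (x : 'cV[R]_n) :
  LP_feasible A b (fun j => x j 0) <-> (forall j, 0 <= x j 0) /\ toF A *m x = toF b.
Proof.
rewrite /LP_feasible; split=> -[x0 Ax]; split.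
- by move=> j; apply/RleP/x0.
- apply/matrixP => i j; rewrite (ord1 j) !mxE -int2RE -Ax.
  by apply: eq_bigr => k _; rewrite mxE int2RE.
- by move=> j; apply/RleP/x0.
move=> i; rewrite int2RE; move/matrixP: Ax => /(_ i 0); rewrite !mxE => <-.
by apply: eq_bigr => k _; rewrite mxE int2RE.
Qed.

Lemma small_step (F : realFieldType) (I : finType) (x v : I -> F) :
  exists2 e, 0 < e & forall i, 0 < x i -> e * `|v i| <= x i.
Proof.
pose S := \sum_(i | 0 < x i) `|v i| / x i.
have S0 : 0 <= S by apply: sumr_ge0 => i xi; rewrite divr_ge0 // ltW.
have S1 : 0 < 1 + S by rewrite ltr_wpDr.
(* Each ratio |v_i| / x_i is at most S; the added 1 keeps the step positive and finite when S =
   0. *)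
exists (1 + S)^-1; first by rewrite invr_gt0.
move=> i xi; rewrite mulrC ler_pdivrMr // mulrC -ler_pdivrMr //.
rewrite /S (bigD1 i) //= addrCA lerDl addr_ge0 ?ler01 //.
by apply: sumr_ge0 => j /andP[xj _]; rewrite divr_ge0 // ltW.
Qed.

Lemma LP_step (m n : nat) (A : 'M[int]_(m, n)) (b : 'cV[int]_m) (x v : 'cV[R]_n) (e : R) :
  LP_feasible A b (fun j => x j 0) -> toF A *m v = 0 ->
  (forall j, 0 < x j 0 -> `|e| * `|v j 0| <= x j 0) ->
  (forall j, e * v j 0 < 0 -> 0 < x j 0) ->
  LP_feasible A b (fun j => (x + e *: v) j 0).
Proof.
move=> /LP_feasibleE[x0 Ax] Av small pos; apply/LP_feasibleE; split.
  move=> j; rewrite 2!mxE; have [ev|/pos xj] := leP 0 (e * v j 0).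
    by rewrite addr_ge0.
  have := small j xj; rewrite -normrM ler_norml => /andP[+ _].
  by rewrite -subr_ge0 opprK addrC.
by rewrite mulmxDr Ax -scalemxAr Av scaler0 addr0.
Qed.

(** For small e both x + e v and x - e v are feasible with midpoint [x], so extremality forces v =
    0. *)
Lemma LP_vertex_kernel (m n : nat) (A : 'M[int]_(m, n)) (b : 'cV[int]_m) (x v : 'cV[R]_n) :
  LP_vertex A b (fun j => x j 0) -> toF A *m v = 0 ->
  (forall j, x j 0 = 0 -> v j 0 = 0) -> v = 0.
Proof.
move=> [xf xvertex] Av xv.
have [x0 _] := proj1 (LP_feasibleE A b x) xf.
have [e e0 small] := small_step (fun j => x j 0) (fun j => v j 0).
have pos (a : R) j : a * v j 0 < 0 -> 0 < x j 0.
  move=> av; rewrite lt_def x0 andbT; apply: contraTneq av => /xv->.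
  by rewrite mulr0 ltxx.
have step (a : R) : `|a| = e -> LP_feasible A b (fun j => (x + a *: v) j 0).
  by move=> ae; apply: LP_step => // [j|j]; [rewrite ae; apply: small | apply: pos].
have h0 : (0 < 2^-1 :> R) by rewrite invr_gt0 ltr0n.
have h1 : (2^-1 < 1 :> R) by rewrite invf_lt1 ?ltr1n ?ltr0n.
have mid j : x j 0 = 2^-1 * (x + e *: v) j 0 + (1 - 2^-1) * (x + (- e) *: v) j 0.
  by rewrite !mxE; field.
have end_eq := xvertex _ _ _ (step e (gtr0_norm e0))
  (step (- e) (etrans (normrN e) (gtr0_norm e0))) (elimT RltP h0) (elimT RltP h1) mid.
apply/matrixP => j l; rewrite (ord1 l) [RHS]mxE.
have [+ _] := end_eq j; rewrite 2!mxE => /(canRL (addKr _)); rewrite addNr => /eqP.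
by rewrite mulf_eq0 (gt_eqF e0) => /eqP.
Qed.

Lemma LP_optimal_kernel (m n : nat) (A : 'M[int]_(m, n)) (b : 'cV[int]_m) (c : 'cV[int]_n)
  (x v : 'cV[R]_n) : LP_optimal A b c (fun j => x j 0) -> toF A *m v = 0 ->
  (forall j, v j 0 < 0 -> 0 < x j 0) -> \sum_j (c j 0)%:~R * v j 0 <= 0.
Proof.
move=> [xf xopt] Av pos.
have [e e0 small] := small_step (fun j => x j 0) (fun j => v j 0).
have objE (y : 'cV[R]_n) : LP_obj c (fun j => y j 0) = \sum_j (c j 0)%:~R * y j 0.
  by apply: eq_bigr => j _; rewrite int2RE.
have /xopt/RleP : LP_feasible A b (fun j => (x + e *: v) j 0).
  apply: LP_step => // [j|j]; first by rewrite gtr0_norm //; apply: small.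
  by rewrite pmulr_rlt0 //; apply: pos.
rewrite !objE; have -> : \sum_j (c j 0)%:~R * (x + e *: v) j 0 =
    \sum_j (c j 0)%:~R * x j 0 + e * \sum_j (c j 0)%:~R * v j 0.
  rewrite mulr_sumr -big_split; apply: eq_bigr => j _ /=.
  by rewrite 2!mxE mulrDr mulrCA.
by rewrite gerDl pmulr_rle0.
Qed.

(** * Full rank, unimodular row operations and the conclusion *)

Lemma Delta_m_gt0 (m n : nat) (A : 'M[int]_(m, n)) :
  int_rank A = m -> (0 < Delta_m A)%N.
Proof.
rewrite /int_rank => rkA.
set Q := map_mx _ A in rkA.
have fQ : row_full Q^T by rewrite /row_full mxrank_tr rkA.
apply: leq_trans (minor_le_Delta_m A (fullrankfun fQ)).
rewrite lt0n absz_eq0 -(intr_eq0 rat) -det_map_mx map_mxsub -/Q -unitfE -unitmxE.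
by rewrite -unitmx_tr trmx_mxsub fullrowsub_unit.
Qed.

Lemma Delta_m_unimodular (m n : nat) (U : 'M[int]_m) (A : 'M[int]_(m, n)) :
  absz (\det U) = 1%N -> Delta_m (U *m A) = Delta_m A.
Proof.
by move=> U1; apply: eq_bigr => g _; rewrite -mulmx_colsub det_mulmx abszM U1 mul1n.
Qed.

Lemma IP_feasible_unimodular (m n : nat) (U : 'M[int]_m) (A : 'M[int]_(m, n))
  (b : 'cV[int]_m) (z : 'cV[int]_n) : U \in unitmx ->
  IP_feasible (U *m A) (U *m b) z <-> IP_feasible A b z.
Proof.
move=> Uu; rewrite /IP_feasible -mulmxA; split=> -[z0 Az]; split=> //; last by rewrite Az.
exact: (can_inj (mulKmx Uu)).
Qed.

Lemma det_upper_triangular_le (m : nat) (M : 'M[int]_m) :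
  upper_triangular M -> (absdet M <= mx_inf_norm M ^ m)%N.
Proof.
move=> Mtri; rewrite /absdet -det_tr det_trig; last first.
  by apply/is_trig_mxP => i j ij; rewrite mxE Mtri.
rewrite (big_morph absz abszM (erefl _)).
apply: (@leq_trans (\prod_(i < m) mx_inf_norm M)%N); last first.
  by rewrite prod_nat_const card_ord.
apply: leq_prod => i _; rewrite mxE /mx_inf_norm.
apply: leq_trans (leq_bigmax (F := fun k => \max_(j < m) absz (M k j)) i).
exact: (leq_bigmax (F := fun j => absz (M i j))).
Qed.

Unset Implicit Arguments.

Theorem theorem2 (m n : nat) (A : 'M[int]_(m, n)) (b : 'cV[int]_m)
  (c : 'cV[int]_n) (f : 'I_m -> 'I_n) (U : 'M[int]_m) :
  leq 1 m ->
  int_rank A = m ->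
  (exists z, IP_feasible A b z) ->
  (exists M : int, forall z, IP_feasible A b z -> obj c z <= M) ->
  (* B = colsub f A is an m x m submatrix (columns kept in increasing order) *)
  (forall i j : 'I_m, leq (nat_of_ord i).+1 j -> leq (nat_of_ord (f i)).+1 (f j)) ->
  Rle (INR (Delta_m A)) (Rmult (INR (absdet (colsub f A))) (gamma_m m)) ->
  absdet U = 1%N ->
  upper_triangular (U *m colsub f A) ->
  forall x : 'I_n -> R,
    LP_vertex (U *m A) (U *m b) x ->
    LP_optimal (U *m A) (U *m b) c x ->
    exists z : 'cV[int]_n,
      IP_optimal (U *m A) (U *m b) c z /\
      Rlt (l1_dist z x)
        (Rmult (Rmult (Rmult
           (Rmult (INR 3) (pow (INR m) 2))
           (log2 (Rmult (Rmult (INR 2)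
                    (sqrt (Rmult (Rmult (INR 2) (INR m)) (log2 (Rplus (INR m) R1)))))
                    (INR (mx_inf_norm (U *m colsub f A))))))
           (gamma_m m))
           (pow (INR (mx_inf_norm (U *m colsub f A))) m)).
Proof.
move=> m0 rkA feas [M bnd] _ hD U1 tri x xvertex xopt.
have Uu : U \in unitmx by rewrite unimodularE; apply/eqP.
have D0 := Delta_m_gt0 rkA.
set UB := U *m colsub f A in tri *.
set H := mx_inf_norm UB.
have detUB : absdet (colsub f A) = absdet UB.
  by rewrite /absdet det_mulmx abszM [absz (\det U)]U1 mul1n.
have detH : leq (absdet (colsub f A)) (expn H m).
  by rewrite detUB; apply: det_upper_triangular_le.
have gm0 : Rlt 0 (gamma_m m) by apply: exp_pos.
(* If H were 0, then det B = 0 because m >= 1, and [hD] would contradict Delta > 0. *)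
have H0 : leq 1 H.
  rewrite lt0n; apply/eqP => H0; move: detH hD; rewrite H0 exp0n // leqn0 => /eqP->.
  have := lt_0_INR _ (elimT ssrnat.ltP D0); rewrite Rmult_0_l; Lra.lra.
have hD' : Rle (INR (Delta_m A)) (Rmult (gamma_m m) (pow (INR H) m)).
  apply: Rle_trans hD _; rewrite Rmult_comm -INR_expn.
  by apply: Rmult_le_compat_l; [Lra.lra | apply/le_INR/ssrnat.leP].
pose X : 'cV[R]_n := \col_j x j.
have xX : x = (fun j => X j 0).
  by apply: functional_extensionality => j; rewrite mxE.
rewrite xX in xvertex xopt *.
have optex : exists z, IP_optimal (U *m A) (U *m b) c z.
  apply: (IP_optimal_exists (M := M)).
    by case: feas => z zf; exists z; apply/IP_feasible_unimodular.
  by move=> z /(IP_feasible_unimodular _ _ _ Uu); apply: bnd.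
have [X0 AX] := proj1 (LP_feasibleE _ _ _) (proj1 xopt).
have [|z [s [zopt hs zX]]] := proximity _ optex X0 AX
    (fun v => LP_vertex_kernel xvertex) (fun v => LP_optimal_kernel xopt).
  by rewrite Delta_m_unimodular.
rewrite Delta_m_unimodular // in hs zX.
have [bound0 le_bound] := bound_estimate m0 D0 H0 hs hD'.
exists z; split=> //.
have -> : l1_dist z (fun j => X j 0) = \sum_j `|(z j 0)%:~R - X j 0|.
  by apply: eq_bigr => j _; rewrite int2RE.
rewrite [INR 2](INR_IZR_INZ 2) [INR 3](INR_IZR_INZ 3).
(* When z = x the distance is 0, and strictness is the positivity of the bound. *)
case: zX => [zX|/RltP].
  rewrite big1 // => j _; move/matrixP: zX => /(_ j 0); rewrite mxE => ->.
  by rewrite subrr normr0.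
by rewrite -INRE => lt_s; apply: Rlt_le_trans lt_s le_bound.
Qed.
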